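(* For all integers $n,m\geq 0$, $$\overline P(n,m) = \#\{(\lambda, \mu)\in \overline{\overline{\mathcal A}}(n,m)\mid \overline\ell(\lambda) \text{ is even}\}-\#\{(\lambda, \mu)\in \overline{\overline{\mathcal A}}(n,m)\mid \overline\ell(\lambda) \text{ is odd}\}.$$
   Context: A partition of $n$ is a finite non-increasing sequence of positive integers (its parts) with sum $n$; the only partition of $0$ is the empty one. An overpartition of $n$ is a partition of $n$ in which the first occurrence of each part size may be overlined or not. The missing integers of an overpartition are the positive integers less than its largest part that do not occur as parts, where an overlined part $\overline i$ counts as an occurrence of $i$ (the empty overpartition has none). $\overline P(n,m)$ denotes the number of overpartitions of $n$ with exactly $m$ missing integers. $\mathcal P$ is the set of all (ordinary) partitions (including the empty one), and $\ell(\mu)$ is the number of parts of $\mu$, counted with multiplicity. A doubly overlined distinct overpartition is a partition with pairwise distinct parts in which each part independently is either non-overlined, singly overlined, or doubly overlined; thus for each positive integer $i$ at most one of $i,\overline i,\overline{\overline i}$ occurs. $\overline{\overline{\mathcal D}}$ is the set of all doubly overlined distinct overpartitions (including the empty one). For $\lambda\in\overline{\overline{\mathcal D}}$, $\overline\ell(\lambda)$ is the number of singly overlined parts of $\lambda$ (doubly overlined parts are not counted). The size $|\lambda|$ is the sum of all parts, ignoring overlines. For $n,m\ge 0$, $$\overline{\overline{\mathcal A}}(n,m)=\{(\lambda,\mu)\mid \lambda\in\overline{\overline{\mathcal D}},\ \mu\in\mathcal P,\ |\lambda|+|\mu|=n,\ \overline\ell(\lambda)=m-\ell(\mu)\}.$$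 *)

(* Defs.v *)
(* MathComp, with the classical sets and finite cardinals of
   mathcomp-classical. *)
From mathcomp Require Export all_boot all_order all_algebra.
From mathcomp Require Export finmap.
From mathcomp Require Export classical_sets cardinality.

Set Implicit Arguments.
Unset Strict Implicit.
Unset Printing Implicit Defensive.

Local Open Scope classical_set_scope.

(* Parts are listed in non-increasing order, so that each partition is exactly
   one sequence. *)
Definition is_partition (s : seq nat) : bool :=
  sorted geq s && all (fun i => 0 < i) s.

(* A decorated part is a pair (i, d) of a size i and a decoration d. *)
Definition sizes (D : Type) (s : seq (nat * D)) : seq nat := unzip1 s.

Definition weight (D : Type) (s : seq (nat * D)) : nat := sumn (sizes s).

(* For overpartitions the decoration is a boolean: (i, true) is an overlined i.
   A part may be overlined only if no earlier part has the same size. *)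
Definition is_overpartition (s : seq (nat * bool)) : bool :=
  is_partition (sizes s) &&
  [forall k : 'I_(size s),
     nth false (unzip2 s) k ==> (nth 0 (sizes s) k \notin take k (sizes s))].

Definition largest_part (s : seq (nat * bool)) : nat := \max_(i <- sizes s) i.

(* iota 1 (L - 1) lists the integers i with 1 <= i < L, and is empty when
   L = 0. *)
Definition missing (s : seq (nat * bool)) : seq nat :=
  [seq i <- iota 1 (largest_part s - 1) | i \notin sizes s].

Definition overpartitions (n m : nat) : set (seq (nat * bool)) :=
  [set s | [&& is_overpartition s, weight s == n & size (missing s) == m]].

(* fset_set A is the finite set with the elements of A when A is finite, and
   the empty set otherwise; the sets counted here are finite, see
   finite_overpartitions and finite_calA. *)
Definition Pbar (n m : nat) : nat := #|` fset_set (overpartitions n m)|.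

(* The decoration is here the number of overlines of the part: 0, 1 or 2. *)
Definition is_ddistinct (s : seq (nat * 'I_3)) : bool :=
  is_partition (sizes s) && uniq (sizes s).

Definition ellbar (s : seq (nat * 'I_3)) : nat :=
  count (fun p => nat_of_ord p.2 == 1) s.

Definition calA (n m : nat) : set (seq (nat * 'I_3) * seq nat) :=
  [set x | [/\ is_ddistinct x.1, is_partition x.2,
               weight x.1 + sumn x.2 = n &
               ((ellbar x.1)%:Z = m%:Z - (size x.2)%:Z)%R]].

Lemma size_le_sumn (s : seq nat) :
  all (fun i => 0 < i) s -> size s <= sumn s.
Proof.
elim: s => //= i s IHs /andP[i_gt0 /IHs le_s].
by rewrite -add1n leq_add.
Qed.

Lemma mem_le_sumn (s : seq nat) i : i \in s -> i <= sumn s.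
Proof.
elim: s => //= j s IHs; rewrite inE => /predU1P[->|/IHs le_i].
  exact: leq_addr.
exact: leq_trans le_i (leq_addl _ _).
Qed.

Lemma finite_decorated (D : finType) (n : nat) :
  finite_set [set s : seq (nat * D) |
                is_partition (sizes s) && (weight s <= n)].
Proof.
pose f (t : {bseq n of 'I_n.+1 * D}) := [seq (nat_of_ord p.1, p.2) | p <- t].
apply: (@sub_finite_set _ _ (f @` setT)); last first.
  by apply: finite_image; exact: finite_finset.
move=> s /= /andP[/andP[_ s_pos] le_sn].
pose t := [seq (inord p.1 : 'I_n.+1, p.2) | p <- s].
have size_t : size t <= n.
  rewrite size_map -(size_map fst); apply: leq_trans le_sn.
  exact: size_le_sumn.
exists (Bseq size_t) => //; rewrite /f /= /t -map_comp -[RHS]map_id.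
apply/eq_in_map => -[i d] s_i /=; rewrite inordK // ltnS.
by apply: leq_trans le_sn; apply: mem_le_sumn; apply/mapP; exists (i, d).
Qed.

Lemma finite_overpartitions (n m : nat) : finite_set (overpartitions n m).
Proof.
apply: sub_finite_set (@finite_decorated bool n) => s /=.
by case/and3P=> /andP[-> _] /eqP-> _ /=.
Qed.

Lemma finite_calA (n m : nat) : finite_set (calA n m).
Proof.
have fin_part : finite_set [set s : seq nat | is_partition s && (sumn s <= n)].
  apply: sub_finite_set (finite_image (@sizes unit)
    (@finite_decorated unit n)) => s /= part_s.
  have sizeK : sizes [seq (i, tt) | i <- s] = s.
    by rewrite /sizes /unzip1 -map_comp map_id.
  by exists [seq (i, tt) | i <- s]; rewrite /weight sizeK.
apply: sub_finite_set (finite_setX (@finite_decorated 'I_3 n) fin_part).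
move=> [lam mu] [/= /andP[lam_part _] mu_part <- _].
by rewrite /setX /= lam_part mu_part leq_addr leq_addl.
Qed.

(* Main.v *)
(* Both sides are coefficients of z^m q^n in generating functions.  Grouping the
   parts of an overpartition by size, with largest part L, gives
     1 + \sum_(L >= 1)
       2 q^L / (1 - q^L) \prod_(1 <= i < L) (z + 2 q^i / (1 - q^i)),
   and the signed count of pairs gives
     \prod_(i >= 1) (1 + (2 - z) q^i) / (1 - z q^i).
   Since z + 2 q^i / (1 - q^i) = (z + (2 - z) q^i) / (1 - q^i), the two agree by
   the q-binomial theorem.  Only q-degrees up to n matter, so the identity is
   proved in an arbitrary commutative ring in which q^(n+1) = 0 and then read in
   Z[z][q] / (q^(n+1)). *)

Require Import Defs.
From mathcomp Require Import ring zify qpoly.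
Import GRing.Theory.

Set Implicit Arguments.
Unset Strict Implicit.
Unset Printing Implicit Defensive.

Local Open Scope classical_set_scope.
Local Open Scope ring_scope.

(** * The q-binomial theorem for nilpotent q *)

Section QBinomial.

Variables (R : comNzRingType) (z q : R) (N : nat).
Hypothesis qN0 : q ^+ N.+1 = 0.

(** As q is nilpotent, for i > 0 [tail i] is q^i / (1 - q^i), and [1 + tail i] is the inverse of 1 -
    q^i. The coefficient [c L] is the product over i < L of (z + (2 - z) q^i) / (1 - q^(i+1)), in
    the shape in which overpartitions produce it. [F j] is the series with coefficients [c] at the
    point q^j. *)
Let tail i := \sum_(k < N) q ^+ (i * k.+1).
Let u i := z + tail i *+ 2.
Let c L := if L is L'.+1 then (1 + tail L) *+ 2 * \prod_(i < L') u i.+1 else 1.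
Let F j := \sum_(L < N.+1) c L * q ^+ (j * L).

Lemma expr_nilp i : (N < i)%N -> q ^+ i = 0.
Proof. by move=> lt_Ni; rewrite -(subnK lt_Ni) exprD qN0 mulr0. Qed.

Lemma expr_nilp_mul i : (0 < i)%N -> q ^+ (i * N.+1) = 0.
Proof. by move=> i_gt0; apply/expr_nilp/leq_pmull. Qed.

Lemma geometric_nilp i (w : R) : (0 < i)%N ->
  (1 - w * q ^+ i) * \sum_(k < N.+1) w ^+ k * q ^+ (i * k) = 1.
Proof.
move=> i_gt0.
under eq_bigr do rewrite exprM -exprMn.
rewrite -[1 - _]opprB mulNr -subrX1 exprMn -exprM.
by rewrite expr_nilp_mul // mulr0 sub0r opprK.
Qed.

Let tailP i : (0 < i)%N -> (1 - q ^+ i) * (1 + tail i) = 1.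
Proof.
move=> i_gt0; rewrite -[RHS](geometric_nilp 1 i_gt0) mul1r; congr (_ * _).
rewrite big_ord_recl /= muln0 mulr1.
by congr (_ + _); apply: eq_bigr => k _; rewrite expr1n mul1r.
Qed.

Let uP i : (0 < i)%N -> (1 - q ^+ i) * u i = z + (2 - z) * q ^+ i.
Proof.
move=> /tailP tailE; rewrite /u.
have -> : (1 - q ^+ i) * (z + tail i *+ 2) =
  (1 - q ^+ i) * (z - 2) + (1 - q ^+ i) * (1 + tail i) * 2 by ring.
by rewrite tailE; ring.
Qed.

(** For L > 0 the passage from [c L] to [c L.+1] trades the factor 1 / (1 - q^L) for [u L] / (1 -
    q^(L+1)), and [uP] evaluates [u L]. For L = 0 the factor z + (2 - z) is the 2 in front of
    [c 1]. *)
Let c_rec L : c L.+1 * (1 - q ^+ L.+1) = c L * (z + (2 - z) * q ^+ L).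
Proof.
have -> : c L.+1 * (1 - q ^+ L.+1) = 2 * \prod_(i < L) u i.+1.
  transitivity ((1 - q ^+ L.+1) * (1 + tail L.+1) *
    (2 * \prod_(i < L) u i.+1)); first by rewrite /c; ring.
  by rewrite tailP // mul1r.
case: L => [|L]; first by rewrite big_ord0 /c; ring.
rewrite big_ord_recr -uP // [in RHS]/c.
transitivity ((1 - q ^+ L.+1) * (1 + tail L.+1) *
  (2 * \prod_(i < L) u i.+1 * u L.+1)); last by ring.
by rewrite tailP //=; ring.
Qed.

(** This is the functional equation behind the q-binomial theorem. With x = q^j, the difference F(x)
    - F(qx) is the sum of c_L (1 - q^L) x^L, which by [c_rec] equals x (z F(x) + (2 - z) F(qx)). *)
Let F_rec j : (0 < j)%N ->
  (1 - z * q ^+ j) * F j = (1 + (2 - z) * q ^+ j) * F j.+1.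
Proof.
move=> j_gt0.
have q0 : q ^+ j * q ^+ (j * N) = 0 by rewrite -exprD -mulnS expr_nilp_mul.
suff FB : F j - F j.+1 = q ^+ j * (z * F j + (2 - z) * F j.+1).
  have FE : F j = F j.+1 + q ^+ j * (z * F j + (2 - z) * F j.+1).
    by rewrite -FB addrC subrK.
  by rewrite mulrBl mul1r {1}FE; ring.
have -> : F j - F j.+1 = \sum_(L < N.+1) c L * (1 - q ^+ L) * q ^+ (j * L).
  rewrite -sumrB; apply: eq_bigr => L _; rewrite mulSn exprD; ring.
rewrite big_ord_recl /= subrr mulr0 mul0r add0r.
under eq_bigr => L _ do rewrite /bump /= add1n c_rec mulnS exprD.
rewrite /F !mulr_sumr -big_split /= mulr_sumr big_ord_recr /=.
(* The shift of the index leaves one extra term, L = N, on the right; it contains q^(j(N+1)) = 0. *)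
rewrite [X in _ = _ + X](_ : _ = 0); last first.
  transitivity (q ^+ j * q ^+ (j * N) * (c N * (z + (2 - z) * q ^+ N))).
    by rewrite mulSn exprD; ring.
  by rewrite q0 mul0r.
rewrite addr0; apply: eq_bigr => L _.
by rewrite mulSn exprD; ring.
Qed.

Let F_prod K : \prod_(i < K) (1 - z * q ^+ i.+1) * F 1 =
  \prod_(i < K) (1 + (2 - z) * q ^+ i.+1) * F K.+1.
Proof.
elim: K => [|K IHK]; first by rewrite !big_ord0.
by rewrite !big_ord_recr /= mulrAC IHK -!mulrA [F _ * _]mulrC F_rec.
Qed.

(* The q-binomial theorem
   [\sum_L (a; q)_L / (q; q)_L (z q)^L = (a z q; q)_oo / (z q; q)_oo]
   at [a = - (2 - z) / z], cleared of the division by [z], and truncated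
   by [q ^+ N.+1 = 0]. *)
Lemma q_binomial_overpartition :
  1 + \sum_(L < N) \sum_(k < N) q ^+ (L.+1 * k.+1) *+ 2 *
        \prod_(i < L) (z + (\sum_(k < N) q ^+ (i.+1 * k.+1)) *+ 2) =
  \prod_(i < N) (1 + (2 - z) * q ^+ i.+1) *
  \prod_(i < N) \sum_(k < N.+1) z ^+ k * q ^+ (i.+1 * k).
Proof.
(* Iterating the functional equation can stop here: each term with L > 0 contains q^((N+1)L) = 0. *)
have FN : F N.+1 = 1.
  rewrite /F big_ord_recl big1 ?addr0 ?muln0 ?mulr1 // => i _.
  by rewrite mulnC expr_nilp_mul // mulr0.
have := F_prod N; rewrite FN mulr1 => <-.
(* Each geometric sum cancels its factor 1 - z q^i, so only [F 1] remains on the right. *)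
rewrite [RHS]mulrAC -big_split /= [X in _ = X * _]big1 => [|i _]; last first.
  exact: geometric_nilp.
rewrite mul1r /F big_ord_recl /= muln0 mulr1; congr (_ + _).
apply: eq_bigr => L _; rewrite /bump /= add1n mul1n -/(u _).
rewrite -mulr_suml [RHS]mulrC mulrA; congr (_ * _).
transitivity (q ^+ L.+1 * (1 + tail L.+1) *+ 2); last by ring.
have := tailP (ltn0Sn L); rewrite sumrMnl -/(tail _) => tailE; congr (_ *+ 2).
have -> : q ^+ L.+1 * (1 + tail L.+1) =
  1 + tail L.+1 - (1 - q ^+ L.+1) * (1 + tail L.+1) by ring.
by rewrite tailE; ring.
Qed.

End QBinomial.

(** * Cardinals through duplicate-free lists, and sortedness as a pairwise condition *)

Lemma card_fset_set_seq (T : choiceType) (A : set T) (s : seq T) :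
  uniq s -> (forall x, A x <-> x \in s) -> #|` fset_set A| = size s.
Proof.
move=> s_uniq AP; have -> : A = [set` [fset x in s]%fset].
  by apply/seteqP; split=> x /=; rewrite !inE => /AP.
by rewrite set_fsetK card_fseq undup_id.
Qed.

(** Unlike [sorted], the form with [pairwise] splits directly over concatenations and passes to
    filtered lists. *)
Lemma sorted_geq_map (T : Type) (sz : T -> nat) (s : seq T) :
  sorted geq (map sz s) = pairwise [rel x y | sz y <= sz x]%N s.
Proof.
rewrite sorted_pairwise ?pairwise_map // => ? ? ? /=; lia.
Qed.

Lemma pairwise_geq_const (T : Type) (sz : T -> nat) (i : nat) (s : seq T) :
  all (fun x => sz x == i) s -> pairwise [rel x y | sz y <= sz x]%N s.
Proof.
elim: s => //= x s IHs /andP[/eqP szx s_i]; rewrite IHs // andbT.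
by apply: sub_all s_i => y /= /eqP->; rewrite szx.
Qed.

(** * Enumerating partition-like lists as stacks of blocks of equal parts *)

Section Stacks.

Variables (T : eqType) (sz : T -> nat) (r : rel T) (B : nat -> seq (seq T)).

(* B i lists the admissible runs of parts of size i. *)
Fixpoint stacks (L : nat) : seq (seq T) :=
  if L is L'.+1 then [seq b ++ s | b <- B L, s <- stacks L'] else [:: [::]].

(** Distributivity turns a weight that is multiplicative over blocks into a product. [W] also takes
    the level, so that it may count the sizes up to L that do not occur. *)
Lemma sum_stacks (R : pzSemiRingType) (W : nat -> seq T -> R)
    (v : nat -> seq T -> R) (L : nat) :
    W 0%N [::] = 1 ->
    (forall i b s, b \in B i.+1 -> s \in stacks i ->
      W i.+1 (b ++ s) = W i s * v i.+1 b) ->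
  \sum_(s <- stacks L) W L s = \prod_(i < L) \sum_(b <- B i.+1) v i.+1 b.
Proof.
move=> W0 WS; elim: L => [|L IHL]; first by rewrite big_seq1 big_ord0.
rewrite big_ord_recr -IHL /= big_allpairs_dep mulr_sumr.
rewrite big_seq [RHS]big_seq; apply: eq_bigr => b Bb.
by rewrite mulr_suml big_seq [RHS]big_seq; apply: eq_bigr => s /WS->.
Qed.

Hypothesis r_neq : forall x y, sz x != sz y -> r x y.
Hypothesis B_sound :
  forall i b, b \in B i -> all (fun x => sz x == i) b && pairwise r b.

(** The relation [r] carries the conditions other than the order of sizes. Parts from different
    blocks have different sizes, where [r] holds by [r_neq], so it only has to be checked inside
    each block. *)
Lemma stacks_sound L s : s \in stacks L ->
  [&& is_partition (map sz s), pairwise r s & all (fun x => sz x <= L)%N s].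
Proof.
elim: L s => [|L IHL] s; first by rewrite inE => /eqP->.
case/allpairsP=> -[b t] /=
  [/B_sound/andP[b_sz b_r] /IHL/and3P[t_part t_r t_le] ->].
have cross x y : x \in b -> y \in t -> (sz y < sz x)%N.
  by move=> /(allP b_sz)/eqP-> /(allP t_le).
move: t_part; rewrite /is_partition !sorted_geq_map.
rewrite !all_map !all_cat !pairwise_cat.
move=> /andP[-> ->]; rewrite (pairwise_geq_const b_sz) b_r t_r !andbT.
rewrite -!andbA; apply/and5P; split.
- by apply/allrelP => x y bx ty; exact/ltnW/cross.
- by apply: sub_all b_sz => x /= /eqP->.
- apply/allrelP => x y bx ty; apply: r_neq.
  by rewrite neq_ltn (cross x y) ?orbT.
- by apply: sub_all b_sz => x /= /eqP->.
- by apply: sub_all t_le => x; apply: leqW.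
Qed.

(** The top block is recovered from the concatenation as its parts of size L + 1, and the rest as
    the other parts, so concatenation is injective here. *)
Lemma stacks_uniq L : (forall i, uniq (B i)) -> uniq (stacks L).
Proof.
move=> B_uniq; elim: L => //= L IHL; apply: allpairs_uniq => //.
have filters b t : b \in B L.+1 -> t \in stacks L ->
    (filter (fun x => sz x == L.+1) (b ++ t) = b) *
    (filter (fun x => sz x != L.+1) (b ++ t) = t).
  move=> /B_sound/andP[b_sz _] /stacks_sound/and3P[_ _ t_le].
  have t_neq : all (fun x => sz x != L.+1) t.
    by apply: sub_all t_le => x /= szx; rewrite neq_ltn ltnS szx.
  rewrite !filter_cat (all_filterP b_sz) (all_filterP t_neq).
  rewrite (@eq_in_filter _ _ pred0 t) ?filter_pred0 ?cats0; last first.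
    by move=> x /(allP t_neq)/negPf->.
  rewrite (@eq_in_filter _ _ pred0 b) ?filter_pred0 //.
  by move=> x /(allP b_sz)/eqP-> /=; rewrite eqxx.
move=> _ _ /allpairsP[[b t] /= [Bb St ->]]
  /allpairsP[[b' t'] /= [Bb' St' ->]] eq_cat.
have := (filters _ _ Bb' St', filters _ _ Bb St).
by rewrite [b' ++ t'](esym eq_cat) => -[[-> ->] [-> ->]].
Qed.

Lemma stacks_complete N L s :
    (forall i b, all (fun x => sz x == i) b -> pairwise r b ->
      (size b <= N)%N -> b \in B i) ->
    is_partition (map sz s) -> pairwise r s -> all (fun x => sz x <= L)%N s ->
    (size s <= N)%N ->
  s \in stacks L.
Proof.
move=> B_complete; rewrite /is_partition sorted_geq_map all_map => /andP[].
elim: L s => [|L IHL] s s_geq s_pos s_r s_le s_N.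
  case: s s_pos s_le {s_geq s_r s_N} => //= x s /andP[szx _] /andP[].
  by rewrite leqNgt szx.
(* In non-increasing order with parts at most L + 1, the parts equal to L + 1 form an initial run;
   this run is the top block. *)
have split_s : s =
    filter (fun x => sz x == L.+1) s ++ filter (fun x => sz x != L.+1) s.
  elim: s s_geq s_le {s_pos s_r s_N} => //= x s IHs.
  move=> /andP[s_x s_geq] /andP[szx s_le].
  case: eqVneq => [_|neq_x] /=; first by rewrite -IHs.
  suff s_neq : all (fun x => sz x != L.+1) s.
    rewrite (all_filterP s_neq) (@eq_in_filter _ _ pred0 s) ?filter_pred0 //.
    by move=> y /(allP s_neq)/negPf->.
  by apply: sub_all s_x => y /=; lia.
rewrite [s]split_s; apply: allpairs_f.
  apply: B_complete; first exact: filter_all.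
    exact: pairwise_filter.
  by apply: leq_trans s_N; rewrite size_filter count_size.
apply: IHL; rewrite ?pairwise_filter //; last 1 first.
- by apply: leq_trans s_N; rewrite size_filter count_size.
- by rewrite all_filter; apply: sub_all s_pos => x /= ->; rewrite implybT.
- rewrite all_filter; apply: sub_all s_le => x /=; apply/implyP; lia.
Qed.

End Stacks.

(** * Blocks for overpartitions, doubly overlined distinct overpartitions and partitions *)

Lemma weight_cat (D : Type) (s t : seq (nat * D)) :
  weight (s ++ t) = (weight s + weight t)%N.
Proof. by rewrite /weight /sizes /unzip1 map_cat sumn_cat. Qed.

Lemma sumn_const (i : nat) (s : seq nat) :
  all (pred1 i) s -> sumn s = (i * size s)%N.
Proof. by move=> /all_pred1P->; rewrite sumn_nseq size_nseq. Qed.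

Lemma weight_const (D : Type) (i : nat) (s : seq (nat * D)) :
  all (fun p => p.1 == i) s -> weight s = (i * size s)%N.
Proof. by move=> s_i; rewrite /weight (@sumn_const i) ?size_map ?all_map. Qed.

(** The overlining rule as a relation between an earlier part [p] and a later part [p'], so that it
    can serve as the [r] of the stacks. *)
Definition overlined_first (p p' : nat * bool) := ~~ (p'.2 && (p'.1 == p.1)).

Lemma is_overpartitionE s :
  is_overpartition s = is_partition (sizes s) && pairwise overlined_first s.
Proof.
congr (_ && _); apply/forallP/(pairwiseP (0, false)) => [H i j | H k].
  rewrite !inE => lt_i lt_j lt_ij; apply/negP => /andP[s_j /eqP eq_ij].
  have /implyP := H (Ordinal lt_j).
  rewrite /unzip2 (nth_map (0, false)) // s_j => /(_ isT)/negP; apply.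
  rewrite /sizes /unzip1 (nth_map (0, false)) // eq_ij.
  rewrite -(nth_map _ 0) // -(nth_take _ lt_ij).
  by rewrite mem_nth // size_take size_map lt_j.
have lt_k := ltn_ord k; rewrite /unzip2 (nth_map (0, false)) //.
apply/implyP => s_k; apply/negP => /(nthP 0) [i].
rewrite size_take size_map lt_k => lt_i.
rewrite nth_take // /sizes /unzip1 !(nth_map (0, false)) ?(ltn_trans lt_i) //.
move=> eq_ik; have /= := H i k (ltn_trans lt_i lt_k) lt_k lt_i.
by rewrite /overlined_first s_k eq_ik eqxx.
Qed.

(** Only the first part of a run may be overlined; [k] counts the parts after it, so the lengths are
    1 to N. The empty block is kept apart because the block of the largest part is never empty. *)
Definition over_blocks1 (N i : nat) : seq (seq (nat * bool)) :=
  [seq (i, d) :: nseq k (i, false) | k <- iota 0 N, d <- [:: false; true]].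

Definition over_blocks (N i : nat) := [::] :: over_blocks1 N i.

Lemma over_blocks1_sound N i b : b \in over_blocks1 N i ->
  [&& b != [::], all (fun p => p.1 == i) b & pairwise overlined_first b].
Proof.
case/allpairsP => -[k d] /= [_ _ ->] /=.
rewrite eqxx !all_nseq /= eqxx orbT /=.
by elim: k => //= k ->; rewrite all_nseq orbT.
Qed.

Lemma over_blocks_sound N i b : b \in over_blocks N i ->
  all (fun p => p.1 == i) b && pairwise overlined_first b.
Proof. by rewrite inE => /predU1P[->|/over_blocks1_sound/and3P[_ -> ->]]. Qed.

Lemma over_blocks_complete N i b :
    all (fun p => p.1 == i) b -> pairwise overlined_first b ->
    (size b <= N)%N ->
  b \in over_blocks N i.
Proof.
case: b => [|[j d] b] //= /andP[/eqP-> b_i] /andP[b_first _] b_N.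
rewrite inE /=; apply/allpairsP; exists (size b, d); split=> /=.
- by rewrite mem_iota.
- by case: (d).
congr (_ :: _); apply/all_pred1P/allP => -[k e] b_ke /=.
have := allP b_first _ b_ke; have /= /eqP-> := allP b_i _ b_ke.
by rewrite /overlined_first /= eqxx andbT => /negPf->.
Qed.

Lemma over_blocks_uniq N i : uniq (over_blocks N i).
Proof.
rewrite /= allpairs_uniq ?iota_uniq // ?andbT.
  by apply/negP => /over_blocks1_sound.
move=> [k d] [k' d'] _ _ /= [-> eq_k].
by have := congr1 size eq_k; rewrite !size_nseq => ->.
Qed.

Lemma overlined_first_neq (p p' : nat * bool) :
  p.1 != p'.1 -> overlined_first p p'.
Proof. by rewrite /overlined_first eq_sym => /negPf->; rewrite andbF. Qed.

Definition ddistinct_blocks (i : nat) : seq (seq (nat * 'I_3)) :=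
  [::] :: [seq [:: (i, d)] | d <- enum 'I_3].

Definition distinct_sizes (D : Type) (p p' : nat * D) := p.1 != p'.1.

Lemma is_ddistinctE s :
  is_ddistinct s = is_partition (sizes s) && pairwise (@distinct_sizes 'I_3) s.
Proof. by rewrite /is_ddistinct uniq_pairwise pairwise_map. Qed.

Lemma ddistinct_blocks_sound i b : b \in ddistinct_blocks i ->
  all (fun p => p.1 == i) b && pairwise (@distinct_sizes 'I_3) b.
Proof. by rewrite inE => /predU1P[->|/mapP[d _ ->]] //=; rewrite eqxx. Qed.

Lemma ddistinct_blocks_complete i b :
    all (fun p => p.1 == i) b -> pairwise (@distinct_sizes 'I_3) b ->
  b \in ddistinct_blocks i.
Proof.
case: b => [|[j d] [|[k e] b]] //=; rewrite inE.
  by rewrite andbT => /eqP-> _; apply/mapP; exists d; rewrite ?mem_enum.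
by rewrite /distinct_sizes /= => /and3P[/eqP-> /eqP-> _]; rewrite eqxx.
Qed.

Lemma ddistinct_blocks_uniq i : uniq (ddistinct_blocks i).
Proof.
rewrite /= map_inj_uniq ?enum_uniq ?andbT; last by move=> d e [].
by apply/mapP => -[].
Qed.

Lemma pairwise_predT (T : Type) (s : seq T) : pairwise (fun _ _ => true) s.
Proof. by elim: s => //= x s ->; rewrite all_predT. Qed.

Definition part_blocks (N i : nat) : seq (seq nat) :=
  [seq nseq k i | k <- iota 0 N.+1].

Lemma part_blocks_sound N i b : b \in part_blocks N i ->
  all (fun j => j == i) b && pairwise (fun _ _ => true) b.
Proof.
by case/mapP=> k _ ->; rewrite pairwise_predT all_nseq eqxx orbT.
Qed.

Lemma part_blocks_complete N i b :
    all (fun j => j == i) b -> (size b <= N)%N -> b \in part_blocks N i.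
Proof.
move=> /all_pred1P b_i b_N; apply/mapP; exists (size b) => //.
by rewrite mem_iota.
Qed.

Lemma part_blocks_uniq N i : uniq (part_blocks N i).
Proof.
rewrite map_inj_uniq ?iota_uniq // => k k' /(congr1 size).
by rewrite !size_nseq.
Qed.

Definition over_stacks N := stacks (over_blocks N).
Definition ddistinct_stacks := stacks ddistinct_blocks.
Definition part_stacks N := stacks (part_blocks N).

(** Weight n bounds each part by n and, the parts being positive, also their number, so blocks of
    length and size at most n suffice. *)
Lemma mem_over_stacks n s :
  weight s = n -> (s \in over_stacks n n) = is_overpartition s.
Proof.
move=> s_n; rewrite is_overpartitionE; apply/idP/andP.
  by case/(stacks_sound overlined_first_neq (@over_blocks_sound n))/and3P.
case=> s_part s_first; have [_ s_pos] := andP s_part.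
apply: (stacks_complete (sz := fst) (N := n) (r := overlined_first)) => //.
- exact: over_blocks_complete.
- by apply/allP => p sp; rewrite -s_n; apply/mem_le_sumn/map_f.
- by rewrite -s_n -(size_map fst) size_le_sumn .
Qed.

Lemma mem_ddistinct_stacks n s :
  (weight s <= n)%N -> (s \in ddistinct_stacks n) = is_ddistinct s.
Proof.
move=> s_n; rewrite is_ddistinctE; apply/idP/andP.
  by case/(stacks_sound (fun _ _ => id) ddistinct_blocks_sound)/and3P.
case=> s_part s_dist; have [_ s_pos] := andP s_part.
apply: (stacks_complete (sz := fst) (N := n) (r := @distinct_sizes 'I_3)) => //.
- by move=> i b b_i b_dist _; apply: ddistinct_blocks_complete.
- by apply/allP => p sp; apply: leq_trans s_n; apply/mem_le_sumn/map_f.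
- by apply: leq_trans s_n; rewrite -(size_map fst) size_le_sumn.
Qed.

Lemma mem_part_stacks n s :
  (sumn s <= n)%N -> (s \in part_stacks n n) = is_partition s.
Proof.
move=> s_n; rewrite -[in RHS](map_id s); apply/idP/idP.
  by case/(stacks_sound (fun _ _ _ => isT) (@part_blocks_sound n))/and3P.
move=> s_part; have [_ s_pos] := andP s_part; rewrite map_id in s_pos.
apply: (stacks_complete (sz := id) (N := n) (r := fun _ _ => true)) => //.
- by move=> i b b_i _; apply: part_blocks_complete.
- exact: pairwise_predT.
- by apply/allP => i si; apply: leq_trans s_n; apply: mem_le_sumn.
- by apply: leq_trans s_n; apply: size_le_sumn.
Qed.

(** * Generating functions of the stacks *)

Section GeneratingFunctions.

Variables (R : comNzRingType) (z q : R).

Lemma sum_over_blocks1 N i :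
  \sum_(b <- over_blocks1 N i) q ^+ weight b =
  \sum_(k < N) q ^+ (i * k.+1) *+ 2.
Proof.
rewrite big_allpairs_dep -[N in iota 0 N]subn0 big_mkord.
apply: eq_bigr => k _; rewrite !big_cons big_nil /= addr0 mulr2n.
by rewrite !(@weight_const _ i) /= ?eqxx ?all_nseq ?eqxx ?orbT ?size_nseq.
Qed.

Lemma sizes_over_blocks1 N i b : b \in over_blocks1 N i -> sizes b =i [:: i].
Proof.
case/over_blocks1_sound/and3P => b_neq0 b_i _ j; rewrite inE.
apply/mapP/eqP => [[p bp ->]|->]; first by apply/eqP/(allP b_i).
case: b b_neq0 b_i => // p b _ /andP[/eqP p_i _].
by exists p; rewrite ?mem_head.
Qed.

Lemma over_stacks_le N L s i :
  s \in over_stacks N L -> i \in sizes s -> (i <= L)%N.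
Proof.
case/(stacks_sound overlined_first_neq (@over_blocks_sound N))/and3P => _ _ s_le.
by case/mapP => p sp ->; apply: (allP s_le).
Qed.

Lemma mem_sizes_block N L b (s : seq (nat * bool)) i : b \in over_blocks1 N L ->
  (i \in sizes (b ++ s)) = (i == L) || (i \in sizes s).
Proof.
move=> /sizes_over_blocks1 b_L; rewrite /sizes /unzip1 map_cat mem_cat.
by congr (_ || _); rewrite b_L inE.
Qed.

(** A nonempty top block makes L + 1 the largest part, so the missing integers are the absent sizes
    from 1 to L, whatever [b] is. *)
Lemma missing_stack N L b s :
  b \in over_blocks1 N L.+1 -> s \in over_stacks N L ->
  missing (b ++ s) = [seq i <- iota 1 L | i \notin sizes s].
Proof.
move=> b_L s_L; have bs_sizes i := mem_sizes_block s i b_L.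
have -> : missing (b ++ s) = [seq i <- iota 1 L | i \notin sizes (b ++ s)].
  congr [seq i <- iota 1 _ | i \notin _].
  suff -> : largest_part (b ++ s) = L.+1.
    by rewrite subn1.
  apply/eqP; rewrite eqn_leq leq_bigmax_seq ?bs_sizes ?eqxx // andbT.
  apply/bigmax_leqP_seq => i; rewrite bs_sizes => /predU1P[-> //|].
  by move=> /(over_stacks_le s_L)/leqW.
apply: eq_in_filter => i; rewrite mem_iota bs_sizes => /andP[_ lt_i].
by rewrite ltn_eqF.
Qed.

(** Absent sizes up to a fixed L, unlike missing integers, form a statistic additive over blocks: an
    empty block contributes z, and the nonempty ones together 2 q^i / (1 - q^i). *)
Lemma sum_over_stacks_absent N L :
  \sum_(s <- over_stacks N L)
     z ^+ count [pred i | i \notin sizes s] (iota 1 L) * q ^+ weight s =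
  \prod_(i < L) (z + (\sum_(k < N) q ^+ (i.+1 * k.+1)) *+ 2).
Proof.
pose v (i : nat) (b : seq (nat * bool)) := z ^+ nilp b * q ^+ weight b.
pose W (L : nat) (s : seq (nat * bool)) :=
  z ^+ count [pred i | i \notin sizes s] (iota 1 L) * q ^+ weight s.
rewrite /over_stacks (sum_stacks (W := W) (v := v)) {}/W ?expr0 ?mul1r //.
  apply: eq_bigr => i _; rewrite big_cons {1}/v expr1 mulr1 -sumrMnl.
  rewrite -sum_over_blocks1; congr (_ + _); rewrite big_seq [RHS]big_seq.
  apply: eq_bigr => b /over_blocks1_sound/and3P[]; rewrite /v.
  by case: b => // p b _ _ _; rewrite mul1r.
move=> i b s Bb Ss; rewrite weight_cat exprD /v mulrACA.
congr (_ * _); last exact: mulrC.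
rewrite -exprD; congr (_ ^+ _).
rewrite -[in iota _ i.+1](addn1 i) iotaD add1n count_cat /= addn0.
(* The parts of [s] are at most [i], so the size [i.+1] is absent exactly when the block is
   empty. *)
move: Bb; rewrite inE => /predU1P[->|Bb].
  congr (_ + _)%N; congr nat_of_bool; apply/negP => /(over_stacks_le Ss).
  by rewrite ltnn.
rewrite (mem_sizes_block _ _ Bb) eqxx /=.
have /and3P[/negPf b_neq0 _ _] := over_blocks1_sound Bb.
rewrite /nilp size_eq0 b_neq0 !addn0; apply: eq_in_count => j.
rewrite mem_iota /= (mem_sizes_block _ _ Bb) => /andP[_ lt_j].
by rewrite ltn_eqF.
Qed.

(** Stacks of height K + 1 with empty top block are those of height K. The others have largest part
    K + 1, and their sum factors into the top block and the absent sizes below it. *)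
Lemma sum_over_stacks N K :
  \sum_(s <- over_stacks N K) z ^+ size (missing s) * q ^+ weight s =
  1 + \sum_(L < K) \sum_(k < N) q ^+ (L.+1 * k.+1) *+ 2 *
        \prod_(i < L) (z + (\sum_(k < N) q ^+ (i.+1 * k.+1)) *+ 2).
Proof.
elim: K => [|K IHK].
  rewrite big_seq1 big_ord0 addr0 /missing /largest_part /weight big_nil.
  by rewrite !expr0 mulr1.
rewrite big_ord_recr /= addrA -IHK /= big_cat big_map /=; congr (_ + _).
rewrite -sum_over_stacks_absent -[\sum_(k < N) _]mulr_suml -sum_over_blocks1.
rewrite big_allpairs_dep mulr_suml big_seq [RHS]big_seq; apply: eq_bigr => b Bb.
rewrite mulr_sumr big_seq [RHS]big_seq; apply: eq_bigr => s Ss.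
by rewrite (missing_stack Bb Ss) size_filter weight_cat exprD mulrCA.
Qed.

(** A part i with 0, 1 or 2 overlines contributes q^i, -z q^i or q^i, which adds up to (2 - z)
    q^i. *)
Lemma sum_ddistinct_stacks L :
  \sum_(s <- ddistinct_stacks L)
     (-1) ^+ ellbar s * z ^+ ellbar s * q ^+ weight s =
  \prod_(i < L) (1 + (2 - z) * q ^+ i.+1).
Proof.
pose v (i : nat) (b : seq (nat * 'I_3)) :=
  (-1) ^+ ellbar b * z ^+ ellbar b * q ^+ weight b.
rewrite /ddistinct_stacks (sum_stacks (W := v) (v := v)).
- apply: eq_bigr => i _; rewrite big_cons big_map big_enum.
  rewrite !big_ord_recl big_ord0.
  rewrite /v /ellbar /weight /= !addn0; ring.
- by rewrite /v !expr0 !mulr1.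
- by move=> i b s _ _; rewrite /v /ellbar count_cat weight_cat !exprD; ring.
Qed.

Lemma sum_part_stacks N L :
  \sum_(s <- part_stacks N L) z ^+ size s * q ^+ sumn s =
  \prod_(i < L) \sum_(k < N.+1) z ^+ k * q ^+ (i.+1 * k).
Proof.
pose v (i : nat) (b : seq nat) := z ^+ size b * q ^+ sumn b.
rewrite /part_stacks (sum_stacks (W := v) (v := v)).
- apply: eq_bigr => i _; rewrite big_map.
  rewrite -(big_mkord xpredT (fun k => z ^+ k * q ^+ (i.+1 * k))).
  rewrite /index_iota subn0.
  by apply: eq_bigr => k _; rewrite /v size_nseq sumn_nseq.
- by rewrite /v !expr0 mulr1.
- by move=> i b s _ _; rewrite /v size_cat sumn_cat !exprD; ring.
Qed.

End GeneratingFunctions.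

(** * From identities with nilpotent q to coefficients *)

Lemma coef_in_qpolyXn (A : comNzRingType) (n i : nat) (p : {poly A}) :
  (i <= n)%N -> (in_qpoly 'X^(n.+1) p : {poly A})`_i = p`_i.
Proof.
move=> le_in; rewrite /= mk_monic_Xn.
by rewrite -Pdiv.RingMonic.take_poly_rmodp coef_take_poly ltnS le_in.
Qed.

(** The constant polynomial ['X%:P] plays the role of z, and the outer indeterminate ['X] that of
    q. *)
Lemma coef_sum_monomials (J : Type) (s : seq J) (e c d : J -> nat) (n m : nat) :
  (\sum_(j <- s) (-1) ^+ e j * 'X%:P ^+ c j * 'X ^+ d j
     : {poly {poly int}})`_n`_m =
  \sum_(j <- s | (c j == m) && (d j == n)) (-1) ^+ e j.
Proof.
rewrite coef_sum coef_sum [RHS]big_mkcond; apply: eq_bigr => j _.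
rewrite -(rmorph_sign polyC) -rmorphXn -rmorphM coefCM coefXn.
rewrite -(rmorph_sign polyC) -mulrA coefCM mulr_natr coefMn coefXn.
rewrite ![m == _]eq_sym ![n == _]eq_sym.
by case: (c j == m); case: (d j == n); rewrite /= ?mulr1 ?mulr0.
Qed.

Lemma coef_transfer (I J : Type) (r : seq I) (s : seq J) (a b : I -> nat)
    (e c d : J -> nat) (n m : nat) :
    (forall (R : comNzRingType) (z q : R), q ^+ n.+1 = 0 ->
      \sum_(i <- r) z ^+ a i * q ^+ b i =
      \sum_(j <- s) (-1) ^+ e j * z ^+ c j * q ^+ d j) ->
  (count [pred i | (a i == m) && (b i == n)] r)%:Z =
  \sum_(j <- s | (c j == m) && (d j == n)) (-1) ^+ e j.
Proof.
pose P : {poly {poly int}} := 'X^(n.+1).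
pose pi : {rmorphism {poly {poly int}} -> {poly %/ P}} := in_qpoly P.
move=> /(_ {poly %/ P} (pi 'X%:P) (pi 'X)) eq_gf.
(* The trivial sign on the left lets [coef_sum_monomials] read off both sides. *)
have {}eq_gf : pi (\sum_(i <- r) (-1) ^+ 0 * 'X%:P ^+ a i * 'X ^+ b i) =
               pi (\sum_(j <- s) (-1) ^+ e j * 'X%:P ^+ c j * 'X ^+ d j).
  rewrite !rmorph_sum.
  transitivity (\sum_(i <- r) pi 'X%:P ^+ a i * pi 'X ^+ b i).
    by apply: eq_bigr => i _; rewrite expr0 mul1r rmorphM !rmorphXn.
  rewrite eq_gf.
    by apply: eq_bigr => j _; rewrite !rmorphM !rmorphXn rmorphN1.
  (* The nilpotency condition holds because q^(n+1) is the modulus itself. *)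
  rewrite -rmorphXn; apply/val_inj => /=; rewrite mk_monic_Xn.
  by rewrite Pdiv.RingMonic.rmodpp // monicXn.
have /(congr1 (fun p : {poly %/ P} => (p : {poly {poly int}})`_n`_m)) := eq_gf.
rewrite /= !coef_in_qpolyXn // !coef_sum_monomials => <-.
by rewrite expr0 -sum1_count -natz natr_sum.
Qed.

Lemma sum_sign_count (J : Type) (s : seq J) (P : pred J) (e : J -> nat) :
  \sum_(j <- s | P j) (-1) ^+ e j =
    (count [pred j | P j && ~~ odd (e j)] s)%:Z
    - (count [pred j | P j && odd (e j)] s)%:Z.
Proof.
elim: s => [|j s IHs]; first by rewrite big_nil.
rewrite big_cons IHs /= -signr_odd.
by case: (P j); case: (odd (e j)) => /=; rewrite ?expr1 ?expr0; lia.
Qed.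

(** * Both sides as counts over stacks, and the identity *)

Definition pair_stacks (n : nat) : seq (seq (nat * 'I_3) * seq nat) :=
  [seq (lam, mu) | lam <- ddistinct_stacks n, mu <- part_stacks n n].

Lemma pair_stacks_uniq n : uniq (pair_stacks n).
Proof.
apply: allpairs_uniq; last by move=> [? ?] [? ?].
- exact: (stacks_uniq (fun _ _ => id) ddistinct_blocks_sound n
    ddistinct_blocks_uniq).
- exact: (stacks_uniq (sz := id) (fun _ _ _ => isT) (@part_blocks_sound n) n
    (part_blocks_uniq n)).
Qed.

(** The integer equation for [ellbar] becomes an additive one in [nat], making m the exponent of z
    in a monomial. [Q] stands for either parity. *)
Lemma card_calA (n m : nat) (Q : pred (seq (nat * 'I_3) * seq nat)) :
  #|` fset_set [set x | calA n m x /\ Q x]| =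
  count [pred x | (ellbar x.1 + size x.2 == m)%N &&
           (weight x.1 + sumn x.2 == n)%N && Q x] (pair_stacks n).
Proof.
rewrite -size_filter; apply: card_fset_set_seq.
  by rewrite filter_uniq ?pair_stacks_uniq.
move=> [lam mu]; rewrite mem_filter /=; split.
  case=> -[/= lam_d mu_p <- ell] ->; rewrite eqxx !andbT; apply/andP; split.
    by apply/eqP; lia.
  by rewrite allpairs_f ?mem_ddistinct_stacks ?mem_part_stacks
    ?leq_addr ?leq_addl.
case/andP=> /andP[/andP[/eqP ell /eqP wt] Qx].
case/allpairsP=> [[l u] /= [l_d u_p [eql equ]]].
rewrite -{}eql -{}equ in l_d u_p; split=> //; split=> //=; last by lia.
- by rewrite -(@mem_ddistinct_stacks n) // -wt leq_addr.
- by rewrite -(@mem_part_stacks n) // -wt leq_addl.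
Qed.

Lemma PbarE (n m : nat) :
  Pbar n m = count [pred s | (size (missing s) == m) && (weight s == n)]
               (over_stacks n n).
Proof.
rewrite -size_filter; apply: card_fset_set_seq.
  rewrite filter_uniq //.
  exact: (stacks_uniq overlined_first_neq (@over_blocks_sound n) n
    (over_blocks_uniq n)).
move=> s; rewrite mem_filter /overpartitions /=; split.
  by case/and3P=> s_op /eqP s_n ->; rewrite s_n eqxx mem_over_stacks.
by case/andP=> /andP[-> /eqP s_n]; rewrite mem_over_stacks // s_n eqxx andbT
  => ->.
Qed.

Theorem mainTheorem2 (n m : nat) :
  (Pbar n m)%:Z =
    (#|` fset_set [set x | calA n m x /\ ~~ odd (ellbar x.1)]|)%:Z
    - (#|` fset_set [set x | calA n m x /\ odd (ellbar x.1)]|)%:Z.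
Proof.
rewrite (card_calA n m (fun x => ~~ odd (ellbar x.1))).
rewrite (card_calA n m (fun x => odd (ellbar x.1))) -sum_sign_count PbarE.
(* The two counts now form one signed sum, so it suffices to compare generating functions for
   nilpotent q. *)
apply: coef_transfer => R z q qn0.
rewrite sum_over_stacks q_binomial_overpartition //.
rewrite -sum_ddistinct_stacks -sum_part_stacks big_allpairs_dep mulr_suml.
apply: eq_bigr => lam _; rewrite mulr_sumr; apply: eq_bigr => mu _ /=.
by rewrite !exprD; ring.
Qed.
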